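(* Let $a\in\mathbb{R}$, let $1<\nu<2$, and let $f:\mathbb{N}_a\to\mathbb{R}$ be a function such that $${}^{C}\Delta_a^{\nu}f(t)\ge -\frac{(t-a)^{(-\nu)}}{\Gamma(1-\nu)}f(a)-\frac{(t-a)^{(1-\nu)}}{\Gamma(2-\nu)}\Delta f(a)\quad\text{for all } t\in\mathbb{N}_{a+2-\nu},$$ and $f(a+1)\ge f(a)\ge 0$. Then $\Delta f(t)\ge 0$ for all $t\in\mathbb{N}_a$.
   Context: For a real number $c$, $\mathbb{N}_c=\{c,c+1,c+2,\dots\}$. $\Delta f(t)=f(t+1)-f(t)$, $\Delta^m=\Delta(\Delta^{m-1})$, $\sigma(s)=s+1$. The falling function is $x^{(\beta)}=\Gamma(x+1)/\Gamma(x+1-\beta)$, with the convention that division at a pole yields zero. For $1<\nu<2$ (so $n=[\nu]+1=2$) the delta left Caputo fractional difference starting from $a$ is $${}^{C}\Delta_a^{\nu}f(t)=\frac{1}{\Gamma(2-\nu)}\sum_{s=a}^{t-(2-\nu)}(t-\sigma(s))^{(1-\nu)}\Delta^2 f(s),\qquad t\in\mathbb{N}_{a+2-\nu}.$$ *)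

(* Defs.v *)
From HB Require Import structures.
From mathcomp Require Import all_boot all_order all_algebra.
From mathcomp Require Import all_classical all_reals all_analysis.
Import Order.TTheory GRing.Theory Num.Theory.
Import numFieldNormedType.Exports.

Set Implicit Arguments.
Unset Strict Implicit.
Unset Printing Implicit Defensive.

Local Open Scope classical_set_scope.
Local Open Scope ring_scope.

Definition euler_Gamma (R : realType) (x : R) : R :=
  \int[lebesgue_measure]_(u in `]0, +oo[) (u `^ (x - 1) * expR (- u)).

(* For x <= 0, n := (Num.truncn (- x)).+1 satisfies 0 < x + n <= 1, and
   Gamma x = Gamma (x + n) / (x (x + 1) ... (x + n - 1)). At a pole
   x = 0, -1, -2, ... the denominator is 0, so that Gamma x = 0 (as y / 0 = 0). *)
Definition Gamma (R : realType) (x : R) : R :=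
  if 0 < x then euler_Gamma x
  else let n := (Num.truncn (- x)).+1 in
       euler_Gamma (x + n%:R) / \prod_(i < n) (x + i%:R).

(* When x + 1 - b is a pole, Gamma (x + 1 - b) = 0, so the quotient is 0: this
   is the convention that division at a pole yields zero. *)
Definition ffall (R : realType) (x b : R) : R :=
  Gamma (x + 1) / Gamma (x + 1 - b).

(* {c, c + 1, c + 2, ...} *)
Definition Nfrom (R : realType) (c : R) : set R :=
  [set c + k%:R | k in [set: nat]].

(* Functions on Nfrom a are represented by functions on R; the notions below
   only use their values on Nfrom a. *)
Definition fdelta (R : realType) (f : R -> R) (t : R) : R := f (t + 1) - f t.

(* Delta left Caputo difference of order nu, 1 < nu < 2, starting from a. The
   sum is over s = a, a + 1, ..., t - (2 - nu), where t \in Nfrom (a + 2 - nu). *)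
Definition caputo_delta (R : realType) (a nu : R) (f : R -> R) (t : R) : R :=
  (Gamma (2 - nu))^-1 *
  \sum_(s \in [set s | Nfrom a s /\ s <= t - (2 - nu)])
     (ffall (t - (s + 1)) (1 - nu) * iter 2 (@fdelta R) f s).

(* Main.v *)
(* Put mu = 2 - nu in (0, 1), g j = Delta f (a + j) and
   c i = Gamma (mu + i) / (i! Gamma mu). At t = a + mu + k the Caputo difference
   is the convolution of c with the differences of g, and the last term of the
   hypothesis is - c (k + 1) g 0; the term in f a is nonnegative because
   Gamma (1 - nu) < 0, and is dropped. Summation by parts turns the hypothesis
   into g (k + 1) >= \sum_(j <= k) (c (k - j) - c (k + 1 - j)) g j. As c is
   nonincreasing, by c (i + 1) / c i = (mu + i) / (i + 1), strong induction
   concludes. *)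
Require Import Defs.
From mathcomp Require Import all_boot all_order all_algebra.
From mathcomp Require Import all_classical all_reals all_analysis measurable_realfun.
From mathcomp Require Import ring lra.
Import Order.TTheory GRing.Theory Num.Theory.
Import numFieldNormedType.Exports.

Local Open Scope classical_set_scope.
Local Open Scope ring_scope.

(** * Positivity from a discrete convolution inequality *)

Lemma nonneg_of_convolution {R : realDomainType} (c g : nat -> R) :
  c 0%N = 1 -> (forall n, c n.+1 <= c n) -> 0 <= g 0%N ->
  (forall n, - (c n.+1 * g 0%N) <=
     \sum_(j < n.+1) c (n - j)%N * (g j.+1 - g j)) ->
  forall n, 0 <= g n.
Proof.
move=> c0 cdecr g0 hconv; elim/ltn_ind => -[//|n IHn].
(* Summation by parts, grouped so that the first two terms are jointly nonnegative by [hconv] and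
   each summand of the last is nonnegative by [cdecr] and induction. *)
have -> : g n.+1 = c n.+1 * g 0%N +
    \sum_(j < n.+1) c (n - j)%N * (g j.+1 - g j) +
    \sum_(j < n.+1) (c (n - j)%N - c (n.+1 - j)%N) * g j.
  have := telescope_sumr (fun j => c (n.+1 - j)%N * g j) (leq0n n.+1).
  rewrite subnn subn0 c0 mul1r big_mkord => /esym/eqP; rewrite subr_eq => /eqP ->.
  rewrite addrC -addrA; congr (_ + _); rewrite -big_split /=.
  by apply: eq_bigr => j _; rewrite subSS; ring.
apply: addr_ge0; first by rewrite addrC -lerBlDr sub0r.
apply: sumr_ge0 => j _; apply: mulr_ge0; last exact: IHn.
by rewrite subr_ge0 subSn ?cdecr// -ltnS.
Qed.

(** * Euler's integral and its functional equation *)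

(** The exhaustion of the half-line by compact intervals along which integrals are computed and
    passed to the limit. *)
Lemma bigcup_itv_inv_nat {R : realType} :
  \bigcup_n `[n.+1%:R^-1, n.+1%:R]%classic = `]0, +oo[%classic :> set R.
Proof.
apply/seteqP; split => x /=.
  move=> [n _]; rewrite /= !in_itv /= andbT => /andP[+ _].
  by apply: lt_le_trans; rewrite invr_gt0.
rewrite in_itv /= andbT => x0.
exists (maxn (Num.truncn x) (Num.truncn x^-1)) => //=.
have le y m : 0 <= y -> (Num.truncn y <= m)%N -> y <= m.+1%:R.
  move=> y0 ym; have /andP[_ /ltW] := truncn_itv y0.
  by move/le_trans; apply; rewrite ler_nat.
rewrite in_itv /= le ?leq_maxl// ?(ltW x0)// andbT.
rewrite -[leRHS]invrK lef_pV2 ?posrE ?invr_gt0//.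
by apply: le; rewrite ?leq_maxr// invr_ge0 ltW.
Qed.

(** For an integer m >= x and u >= 1, u ^ x * u <= u ^ (m + 1) <= (m + 1)! * exp u, so the term is
    at most (m + 1)! / u. *)
Lemma cvg_powR_expRN_natr {R : realType} (x : R) :
  n.+1%:R `^ x * expR (- n.+1%:R) @[n --> \oo] --> (0 : R).
Proof.
pose m := (Num.truncn `|x|).+1.
have xm : x <= m%:R.
  by apply: le_trans (ler_norm x) _; have /andP[_ /ltW] := truncn_itv (normr_ge0 x).
apply: (@squeeze_cvgr _ _ _ _ (fun=> 0) (fun n => m.+1`!%:R * harmonic n)).
- near=> n; set u := n.+1%:R.
  have u1 : 1 <= u by rewrite ler1n.
  have u0 : 0 < u by exact: lt_le_trans u1.
  rewrite mulr_ge0 ?powR_ge0 ?expR_ge0//=.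
  rewrite expRN ler_pdivrMr ?expR_gt0// mulrAC ler_pdivlMr//.
  apply: (@le_trans _ _ (u ^+ m.+1)).
    by rewrite exprSr -powR_mulrn ?(ltW u0)// ler_pM2r// ler_powR.
  have fp : 0 < m.+1`!%:R :> R by rewrite ltr0n fact_gt0.
  rewrite mulrC -ler_pdivrMr//.
  by apply: le_trans (expR_ge1Dxn m (ltW u0)); rewrite lerDr.
- exact: cvg_cst.
- by rewrite -(mulr0 m.+1`!%:R); apply: cvgMl_tmp; exact: cvg_harmonic.
Unshelve. all: by end_near. Qed.

Lemma cvg_powR_expRN_harmonic {R : realType} (x : R) : 0 < x ->
  n.+1%:R^-1 `^ x * expR (- n.+1%:R^-1) @[n --> \oo] --> (0 : R).
Proof.
move=> x0.
have expc : expR (- u) @[u --> (0 : R)^'+] --> expR (- 0).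
  apply: cvg_at_right_filter; apply: continuous_comp; last exact: continuous_expR.
  exact: opp_continuous.
have lim0 : u `^ x * expR (- u) @[u --> (0 : R)^'+] --> (0 : R).
  by have := cvgM (powR_cvg0 x0) expc; rewrite mul0r; exact.
move/cvg_at_rightP : lim0; apply; split => [n|]; last exact: cvg_harmonic.
by rewrite invr_gt0.
Qed.

Lemma measurable_powR_expRN {R : realType} (D : set R) (p : R) :
  measurable_fun D (fun u => u `^ p * expR (- u)).
Proof.
apply: measurable_funTS; apply: measurable_funM.
  exact: measurable_powR.
by apply: measurableT_comp => //; exact: oppr_measurable.
Qed.

(** By parts, with - exp (- u) as antiderivative of exp (- u). [0 < a] keeps away from 0, where u ^
    x may fail to be differentiable; [0 <= x] fixes the sign of the integrand, so that constants
    come out without an integrability argument. *)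
Lemma integral_powR_expRN_itv {R : realType} (x a b : R) :
  0 <= x -> 0 < a -> a < b ->
  (\int[lebesgue_measure]_(u in `[a, b]) (u `^ x * expR (- u))%:E =
   (a `^ x * expR (- a) - b `^ x * expR (- b))%:E +
   x%:E * \int[lebesgue_measure]_(u in `[a, b]) (u `^ (x - 1) * expR (- u))%:E)%E.
Proof.
move=> x0 a0 ab; have b0 := lt_trans a0 ab.
have powc p u : 0 < u -> {for u, continuous (fun v : R => v `^ p)}.
  move=> u0; apply: differentiable_continuous; apply/derivable1_diffP.
  by apply: derivable_powR; rewrite in_itv/= u0.
have expc : continuous (fun u : R => expR (- u)).
  move=> u; apply: continuous_comp; last exact: continuous_expR.
  exact: opp_continuous.
have expcN : continuous (fun u : R => - expR (- u)).
  by move=> u; apply: cvgN; exact: expc.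
rewrite (@integration_by_parts R (fun u => u `^ x) (fun u => - expR (- u))
   (fun u => x * u `^ (x - 1)) (fun u => expR (- u)))//.
- rewrite !mulrN opprK [(- _ + _)%R]addrC; congr (_ + _)%E.
  rewrite -ge0_integralZl_EFin//.
  + under [in LHS]eq_integral do rewrite mulrN -mulrA EFinN EFinM.
    rewrite integral_ge0N ?oppeK// => u _.
    by rewrite -EFinM lee_fin !mulr_ge0 ?powR_ge0 ?expR_ge0.
  + by move=> u _; rewrite lee_fin mulr_ge0 ?powR_ge0 ?expR_ge0.
  + by apply/measurable_EFinP; exact: measurable_powR_expRN.
- apply: continuous_in_subspaceT => u; rewrite inE/= in_itv/= => /andP[au _].
  apply: cvgM; first exact: cvg_cst.
  by apply: powc; exact: lt_le_trans au.
- split => [u||].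
  + rewrite in_itv/= => /andP[au _].
    by apply: derivable_powR; rewrite in_itv/= andbT (lt_trans a0).
  + exact/cvg_at_right_filter/powc.
  + exact/cvg_at_left_filter/powc.
- move=> u; rewrite in_itv/= => /andP[au ub]; apply: powR_derive1.
  by rewrite in_itv/= andbT (lt_trans a0).
- exact: continuous_subspaceT.
- split => [u _||]; first exact: ex_derive.
    exact/cvg_at_right_filter/expcN.
  exact/cvg_at_left_filter/expcN.
- by move=> u _; rewrite derive1E derive_val mulrN1 opprK.
Qed.

(** The integral behind [euler_Gamma], kept in the extended reals until it is known to be finite. *)
Definition euler_integral {R : realType} (x : R) : \bar R :=
  (\int[lebesgue_measure]_(u in `]0%R, +oo[) (u `^ (x - 1) * expR (- u))%:E)%E.

(** Monotone convergence along the exhaustion, as the integrand is nonnegative. *)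
Lemma cvg_euler_integral {R : realType} (x : R) :
  (\int[lebesgue_measure]_(u in `[(n.+1%:R^-1)%R, n.+1%:R%R])
     (u `^ (x - 1) * expR (- u))%:E)%E
  @[n --> \oo] --> euler_integral x.
Proof.
rewrite /euler_integral -bigcup_itv_inv_nat.
apply: ge0_nondecreasing_set_cvg_integral => //.
- move=> m n mn; apply/subsetPset => u /=; rewrite !in_itv/= => /andP[mu um].
  rewrite (le_trans um) ?ler_nat// andbT (le_trans _ mu)//.
  by rewrite lef_pV2 ?posrE// ler_nat.
- by move=> n; apply/measurable_EFinP; exact: measurable_powR_expRN.
- by move=> n u _; rewrite lee_fin mulr_ge0 ?powR_ge0 ?expR_ge0.
Qed.

(* By parts on [1 / (n + 1), n + 1]. The limit is taken in the extended reals,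
   so that finiteness is not needed here; it is derived from this identity. *)
Lemma euler_integralS {R : realType} (x : R) : 0 < x ->
  euler_integral (x + 1) = (x%:E * euler_integral x)%E.
Proof.
move=> x0; have := cvg_euler_integral (x + 1); rewrite addrK => limS.
rewrite -(cvg_lim (@ereal_hausdorff R) limS).
apply: cvg_lim; first exact: ereal_hausdorff.
(* The boundary term of the integration by parts; it vanishes at both ends. *)
pose b (n : nat) : R := n.+1%:R^-1 `^ x * expR (- n.+1%:R^-1) -
  n.+1%:R `^ x * expR (- n.+1%:R).
have b0 : (b n)%:E @[n --> \oo] --> (0 : \bar R)%E.
  apply: cvg_EFin; first by near=> n.
  rewrite -(subr0 (0 : R)).
  exact: (cvgB (cvg_powR_expRN_harmonic x x0) (cvg_powR_expRN_natr x)).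
rewrite -[X in _ --> X]add0e.
apply: cvg_trans (cvgeD _ b0 (cvgeZl _ (cvg_euler_integral x))) => //.
apply: near_eq_cvg; near=> n => /=.
(* For n = 0 the interval degenerates to [1, 1], while the integration by parts asks for distinct
   endpoints. *)
have n1 : (0 < n)%N by near: n; exact: nbhs_infty_gt.
rewrite [RHS]integral_powR_expRN_itv ?(ltW x0)//.
by apply: (@lt_trans _ _ 1); rewrite ?invf_lt1 ?ltr1n.
Unshelve. all: by end_near. Qed.

(** * Positivity and finiteness of Euler's integral *)

Lemma euler_integral_ge0 {R : realType} (x : R) : (0 <= euler_integral x)%E.
Proof.
apply: integral_ge0 => u _.
by rewrite lee_fin mulr_ge0 ?powR_ge0 ?expR_ge0.
Qed.

(** This is the total mass of the exponential distribution of rate 1. *)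
Lemma euler_integral1 {R : realType} : euler_integral (1 : R) = 1%E.
Proof.
rewrite -(@integral_exponential_pdf R 1)//.
rewrite /euler_integral subrr.
rewrite integral_itv_obnd_cbnd.
  rewrite integral_mkcond; apply: eq_integral => u _.
  rewrite /exponential_pdf !patchE; case: ifP => //.
  by rewrite powRr0 !mul1r mulN1r.
by apply/measurable_EFinP; exact: measurable_powR_expRN.
Qed.

Lemma le_euler_integralD {R : realType} (x y z : R) :
  (forall u, 0 < u -> u `^ (x - 1) <= u `^ (y - 1) + u `^ (z - 1)) ->
  (euler_integral x <= euler_integral y + euler_integral z)%E.
Proof.
move=> le_xyz; rewrite /euler_integral -ge0_integralD//=.
- apply: ge0_le_integral => //=.
  + by move=> u _; rewrite lee_fin mulr_ge0 ?powR_ge0 ?expR_ge0.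
  + by apply/measurable_EFinP; exact: measurable_powR_expRN.
  + by apply: emeasurable_funD; apply/measurable_EFinP; exact: measurable_powR_expRN.
  + move=> u; rewrite in_itv/= andbT => u0.
    by rewrite -EFinD lee_fin -mulrDl ler_pM2r ?expR_gt0// le_xyz.
- by move=> u _; rewrite lee_fin mulr_ge0 ?powR_ge0 ?expR_ge0.
- by apply/measurable_EFinP; exact: measurable_powR_expRN.
- by move=> u _; rewrite lee_fin mulr_ge0 ?powR_ge0 ?expR_ge0.
- by apply/measurable_EFinP; exact: measurable_powR_expRN.
Qed.

Lemma euler_integral_le1 {R : realType} (x : R) : 0 < x <= 1 ->
  (0 < euler_integral x < +oo)%E.
Proof.
move=> /andP[x0 x1].
have EI2 : euler_integral (1 + 1 : R) = 1%E.
  by rewrite euler_integralS// euler_integral1 mule1.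
(* u ^ x <= 1 + u bounds x * euler_integral x = euler_integral (x + 1);
   1 <= u ^ (x - 1) + u ^ x gives positivity below. *)
have lt_oo : (euler_integral x < +oo)%E.
  rewrite ltey; apply/negP => /eqP EIoo.
  have : (euler_integral (x + 1) <=
      euler_integral (1 : R) + euler_integral (1 + 1 : R))%E.
    apply: le_euler_integralD => u u0; rewrite !addrK subrr powRr0 powRr1 ?(ltW u0)//.
    have [u1|u1] := leP u 1.
      rewrite -[leLHS]addr0 lerD ?(ltW u0)// -(powRr0 u).
      by apply: ger_powR; rewrite ?u0 ?u1// ltW.
    rewrite -[leLHS]add0r lerD// -[leRHS]powRr1 ?(ltW u0)//.
    by apply: ler_powR => //; exact: ltW.
  by rewrite euler_integralS// EIoo gt0_muley ?lte_fin// EI2 euler_integral1.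
rewrite lt_oo andbT lt_neqAle euler_integral_ge0 andbT; apply/negP => /eqP EI0.
have : (euler_integral (1 : R) <= euler_integral x + euler_integral (x + 1))%E.
  apply: le_euler_integralD => u u0; rewrite subrr addrK powRr0.
  have [u1|u1] := leP u 1.
    rewrite -[leLHS]addr0 lerD ?powR_ge0// -[leLHS](powRr0 u).
    by apply: ger_powR; rewrite ?u0 ?u1// subr_le0.
  rewrite -[leLHS]add0r lerD ?powR_ge0// -[leLHS](powRr0 u).
  by apply: ler_powR; exact: ltW.
by rewrite euler_integralS// -EI0 mule0 adde0 euler_integral1 lee_fin ler10.
Qed.

(** Induction on an integer bound of [x]: the functional equation lowers [x] by 1 until it lies in
    (0, 1]. *)
Lemma euler_integral_gt0_lty {R : realType} (x : R) : 0 < x ->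
  (0 < euler_integral x < +oo)%E.
Proof.
move=> x0; have : x <= (Num.truncn x).+1%:R.
  by have /andP[_ /ltW] := truncn_itv (ltW x0).
move: (Num.truncn x) => n; elim: n x x0 => [|n IHn] x x0 xn.
  by apply: euler_integral_le1; rewrite x0.
have [x1|x1] := leP x 1; first by apply: euler_integral_le1; rewrite x0.
have xB1 : 0 < x - 1 by rewrite subr_gt0.
have /andP[I0 Ioo] : (0 < euler_integral (x - 1) < +oo)%E.
  by apply: IHn => //; rewrite lerBlDr natr1.
rewrite -(subrK 1 x) euler_integralS// mule_gt0//=.
by rewrite lte_mul_pinfty// lee_fin ltW.
Qed.

(** * Values and signs of the Gamma function *)

Lemma Gamma_euler_integral {R : realType} (x : R) : 0 < x ->
  (Gamma x)%:E = euler_integral x.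
Proof.
move=> x0; rewrite /Gamma x0 /euler_Gamma /Rintegral fineK//.
have /andP[I0 Ioo] := euler_integral_gt0_lty x x0.
by rewrite ge0_fin_numE// ltW.
Qed.

Lemma Gamma_gt0 {R : realType} (x : R) : 0 < x -> 0 < Gamma x.
Proof.
move=> x0; rewrite -lte_fin Gamma_euler_integral//.
by case/andP: (euler_integral_gt0_lty x x0).
Qed.

Lemma GammaS {R : realType} (x : R) : 0 < x -> Gamma (x + 1) = x * Gamma x.
Proof.
move=> x0; apply: EFin_inj; rewrite EFinM !Gamma_euler_integral ?addr_gt0//.
exact: euler_integralS.
Qed.

Lemma Gamma_natS {R : realType} (n : nat) : Gamma n.+1%:R = n`!%:R :> R.
Proof.
elim: n => [|n IHn].
  by apply: EFin_inj; rewrite Gamma_euler_integral// euler_integral1.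
by rewrite -natr1 GammaS ?ltr0n// IHn factS natrM.
Qed.

(** On (-1, 0) the product in [Gamma] has the single factor x, so Gamma x = Gamma (x + 1) / x with a
    positive numerator. *)
Lemma Gamma_lt0 {R : realType} (x : R) : -1 < x < 0 -> Gamma x < 0.
Proof.
move=> /andP[xN1 x0]; rewrite /Gamma (lt_gtF x0)/=.
have -> : Num.truncn (- x) = 0%N.
  by apply/truncn0Pn; rewrite -ltNge; lra.
rewrite big_ord_recl big_ord0 mulr1 addr0.
have x1 : 0 < x + 1 by lra.
rewrite pmulr_rlt0 ?invr_lt0//.
by have := Gamma_gt0 _ x1; rewrite /Gamma x1.
Qed.

(** * The Caputo difference as a convolution *)

Lemma fsbig_Nfrom_le {R : realType} (a : R) (k : nat) (F : R -> R) :
  \sum_(s \in [set s | Nfrom a s /\ s <= a + k%:R]) F s =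
  \sum_(j < k.+1) F (a + j%:R).
Proof.
have -> : [set s | Nfrom a s /\ s <= a + k%:R] =
    [set` [seq a + j%:R | j <- iota 0 k.+1]].
  apply/seteqP; split => s.
    move=> [[j _ <-]]; rewrite lerD2l ler_nat => jk.
    by apply/mapP; exists j; rewrite // mem_iota.
  move=> /mapP[j]; rewrite mem_iota add0n ltnS => /andP[_ jk] ->.
  by split; [exists j|rewrite lerD2l ler_nat].
rewrite -fsbig_seq; last first.
  by rewrite map_inj_uniq ?iota_uniq// => i j /addrI /eqP; rewrite eqr_nat => /eqP.
by rewrite big_map -(big_mkord xpredT (fun j => F (a + j%:R))) /index_iota subn0.
Qed.

Lemma caputo_deltaE {R : realType} (a nu : R) (f : R -> R) (k : nat) :
  caputo_delta a nu f (a + 2 - nu + k%:R) =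
  \sum_(j < k.+1) Gamma (2 - nu + (k - j)%:R) / (k - j)`!%:R / Gamma (2 - nu) *
    (fdelta f (a + j.+1%:R) - fdelta f (a + j%:R)).
Proof.
rewrite /caputo_delta.
have -> : a + 2 - nu + k%:R - (2 - nu) = a + k%:R by ring.
rewrite fsbig_Nfrom_le big_distrr; apply: eq_bigr => j _ /=.
have jk : (j <= k)%N by rewrite -ltnS.
rewrite /ffall natrB//.
have -> : a + 2 - nu + k%:R - (a + j%:R + 1) + 1 = 2 - nu + (k%:R - j%:R) by ring.
(* The denominator of the falling function is Gamma at a positive integer: a factorial, never a
   pole. *)
have -> : 2 - nu + (k%:R - j%:R) - (1 - nu) = (k - j).+1%:R.
  by rewrite -[(k - j).+1]addn1 natrD natrB//; ring.
have -> : fdelta (fdelta f) (a + j%:R) =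
    fdelta f (a + j.+1%:R) - fdelta f (a + j%:R) by rewrite -natr1 addrA.
by rewrite Gamma_natS; ring.
Qed.

(** * Monotonicity from the Caputo inequality *)

Theorem theorem3p1 (R : realType) (a nu : R) (hnu : 1 < nu < 2) (f : R -> R)
    (hcaputo : forall t : R, Nfrom (a + 2 - nu) t ->
       caputo_delta a nu f t >=
         - (ffall (t - a) (- nu) / Gamma (1 - nu)) * f a
         - ffall (t - a) (1 - nu) / Gamma (2 - nu) * fdelta f a)
    (hfa1 : f (a + 1) >= f a) (hfa : f a >= 0) :
  forall t : R, Nfrom a t -> fdelta f t >= 0.
Proof.
move=> _ [n _ <-]; have /andP[nu1 nu2] := hnu.
have mu0 : 0 < 2 - nu by lra.
have Gmu0 := Gamma_gt0 _ mu0.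
pose c i : R := Gamma (2 - nu + i%:R) / i`!%:R / Gamma (2 - nu).
move: n; apply: (@nonneg_of_convolution R c (fun j => fdelta f (a + j%:R))).
- by rewrite /c addr0 fact0 divr1 divff// gt_eqF.
- move=> i; rewrite /c ler_pM2r ?invr_gt0//.
  have mui0 : 0 < 2 - nu + i%:R by rewrite ltr_wpDr.
  have -> : 2 - nu + i.+1%:R = 2 - nu + i%:R + 1 by ring.
  rewrite GammaS// factS natrM invfM mulrACA -[leRHS]mul1r.
  rewrite ler_wpM2r ?divr_ge0 ?(ltW (Gamma_gt0 _ mui0))//.
  rewrite ler_pdivrMr ?ltr0n// mul1r -[i.+1]addn1 natrD; lra.
- by rewrite addr0 /fdelta subr_ge0.
- move=> k; rewrite -caputo_deltaE.
  apply: le_trans (hcaputo _ _); last by exists k.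
  rewrite addr0 /ffall.
  (* With these arguments the falling function of order 1 - nu is Gamma (2 - nu + (k + 1)) / (k +
     1)!, which makes the last term of the hypothesis exactly the one with [c k.+1]. *)
  have -> : a + 2 - nu + k%:R - a + 1 = 2 - nu + k.+1%:R by ring.
  have -> : 2 - nu + k.+1%:R - (1 - nu) = k.+2%:R by ring.
  rewrite Gamma_natS lerDr mulr_ge0// oppr_ge0.
  rewrite pmulr_rle0 ?invr_le0; first by apply/ltW/Gamma_lt0; lra.
  have k0 : 0 <= k.+1%:R :> R by rewrite ler0n.
  by rewrite divr_gt0//; apply: Gamma_gt0; lra.
Qed.
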